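(* Let $(Q^n)_{n\in\overline{\mathbb N}}$ be transition kernels on $\mathbb X$ and let $(f^n)_{n\in\overline{\mathbb N}}$ be bounded and non-negative reward functions. Assume the discount function satisfies $\delta(t+s)\ge\delta(t)\delta(s)$ for all $s,t\in\mathbb N$. Suppose that $Q^n$ converges to $Q^\infty$ uniformly in total variation and that $\|f^n-f^\infty\|_\infty\to0$. Then, for every $x\in\mathbb X$, $$\lim_{\varepsilon\searrow0}\Big(\liminf_{n\to\infty}V^{Q^n}_\varepsilon(x,f^n)\Big)=\lim_{\varepsilon\searrow0}\Big(\liminf_{n\to\infty}W^{Q^n}_\varepsilon(x,f^n)\Big)=\lim_{\varepsilon\searrow0}\Big(\limsup_{n\to\infty}V^{Q^n}_\varepsilon(x,f^n)\Big)=\lim_{\varepsilon\searrow0}\Big(\limsup_{n\to\infty}W^{Q^n}_\varepsilon(x,f^n)\Big)=V^{Q^\infty}(x,f^\infty).$$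
   Context: $\mathbb X$ is a Polish space with Borel $\sigma$-algebra $\mathcal B$; $\mathbb N=\{0,1,2,\dots\}$, $\overline{\mathbb N}=\mathbb N\cup\{\infty\}$. $X=(X_t)_{t\in\mathbb N}$ is a time-homogeneous discrete-time Markov process with values in $\mathbb X$. For a transition kernel $Q$ on $\mathbb X$, $\mathbb E^Q_x$ is the expectation when $X$ has transition kernel $Q$ and $X_0=x$. The discount function $\delta:\mathbb N\to[0,1]$ is fixed, decreasing (in the weak sense), with $\delta(0)=1$, $\delta(1)<1$, $\lim_{t\to\infty}\delta(t)=0$. A reward function is a Borel function $f:\mathbb X\to[0,\infty)$; $\|f\|_\infty=\sup_{x}|f(x)|$. Convention: $\delta(\tau)f(X_\tau)=0$ on $\{\tau=\infty\}$. For $S\in\mathcal B$ let $\rho(S)=\inf\{t\ge1: X_t\in S\}$ ($\inf\emptyset=\infty$) and $J^Q(x,S,f)=\mathbb E^Q_x[\delta(\rho(S))f(X_{\rho(S)})]$ if $x\notin S$, $J^Q(x,S,f)=f(x)$ if $x\in S$. For $\varepsilon\ge0$: $S\in\mathcal B$ is an $\varepsilon$-equilibrium (w.r.t. $f,Q$) if $f(x)\le\mathbb E^Q_x[\delta(\rho(S))f(X_{\rho(S)})]+\varepsilon$ for all $x\notin S$ and $f(x)+\varepsilon\ge\mathbb E^Q_x[\delta(\rho(S))f(X_{\rho(S)})]$ for all $x\in S$; $S\in\mathcal B$ is a pseudo $\varepsilon$-equilibrium if only the first condition (for all $x\notin S$) is required. $\mathcal E^Q(f,\varepsilon)$ and $\mathcal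 G^Q(f,\varepsilon)$ denote the sets of $\varepsilon$-equilibria and pseudo $\varepsilon$-equilibria respectively. Put $$V^Q_\varepsilon(x,f)=\sup_{S\in\mathcal E^Q(f,\varepsilon)}J^Q(x,S,f),\qquad W^Q_\varepsilon(x,f)=\sup_{S\in\mathcal G^Q(f,\varepsilon)}J^Q(x,S,f),\qquad V^Q(x,f)=V^Q_0(x,f).$$ Total variation: $\|\mu-\nu\|_{TV}=\sup\{\int g\,d\mu-\int g\,d\nu\}$ over Borel $g:\mathbb X\to[0,1]$. $Q^n\to Q^\infty$ uniformly in total variation means $\lim_{n\to\infty}\sup_{x\in\mathbb X}\|Q^n(x,\cdot)-Q^\infty(x,\cdot)\|_{TV}=0$. *)

(* Defs.v *)
From HB Require Import structures.
From mathcomp Require Import all_boot all_order all_algebra.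
From mathcomp Require Import all_classical all_reals all_analysis.
Import Order.TTheory GRing.Theory Num.Theory.
Import numFieldNormedType.Exports.

Set Implicit Arguments.
Unset Strict Implicit.
Unset Printing Implicit Defensive.

Local Open Scope classical_set_scope.
Local Open Scope ring_scope.

Notation borel T := (g_sigma_algebraType (@open T)).

Record is_metric (R : realType) (T : Type) (d : T -> T -> R) : Prop :=
  IsMetric {
    metric_ge0 : forall x y, 0 <= d x y;
    metric_eq0 : forall x y, d x y = 0 <-> x = y;
    metric_sym : forall x y, d x y = d y x;
    metric_triangle : forall x y z, d x z <= d x y + d y z }.

Definition metric_complete (R : realType) (T : Type) (d : T -> T -> R) : Prop :=
  forall u : nat -> T,
    (forall e, 0 < e -> exists N, forall m n, (N <= m)%N -> (N <= n)%N ->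
       d (u m) (u n) < e) ->
    exists l, forall e, 0 < e -> exists N, forall n, (N <= n)%N ->
       d (u n) l < e.

Definition metrizes (R : realType) (T : topologicalType) (d : T -> T -> R) :
    Prop :=
  forall (x : T) (A : set T),
    nbhs x A <-> exists2 e, 0 < e & [set y | d x y < e] `<=` A.

Definition polish_space (R : realType) (T : topologicalType) : Prop :=
  (exists2 D : set T, countable D & dense D) /\
  exists d : T -> T -> R, [/\ is_metric d, metrizes d & metric_complete d].

Section Markov.
Context (R : realType) (T : ptopologicalType).
Context (dO : measure_display) (Omega : measurableType dO).

Definition natural_filtration (X : nat -> {mfun Omega >-> borel T}) (t : nat) :
    set (set Omega) :=
  <<s [set A | exists i (B : set (borel T)),
         [/\ (i <= t)%N, measurable B & A = X i @^-1` B]] >>.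

(* The second clause says that Q (X_t) B is a version of the conditional
   probability of {X_(t+1) \in B} given the natural filtration at time t. *)
Definition is_markov (X : nat -> {mfun Omega >-> borel T})
    (Q : R.-pker borel T ~> borel T) (x : T) (P : probability Omega R) : Prop :=
  P (X 0%N @^-1` [set x]) = 1%E /\
  forall t (A : set Omega) (B : set (borel T)),
    natural_filtration X t A -> measurable B ->
    P (A `&` X t.+1 @^-1` B) = (\int[P]_(w in A) Q (X t w) B)%E.

(* The process X is fixed; under Prob Q x it has transition kernel Q and
   starts from x. The canonical process on the path space is an instance, by
   the Ionescu-Tulcea theorem. *)
Definition markov_family (X : nat -> {mfun Omega >-> borel T})
    (Prob : (R.-pker borel T ~> borel T) -> T -> probability Omega R) : Prop :=
  forall Q x, is_markov X Q x (Prob Q x).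

Variable X : nat -> {mfun Omega >-> borel T}.
Variable Prob : (R.-pker borel T ~> borel T) -> T -> probability Omega R.
Variable delta : nat -> R.

(* None stands for infinity. *)
Definition hitting_time (S : set T) (w : Omega) : option nat :=
  match pselect (exists t, (1 <= t)%N && (X t w \in S)) with
  | left h => Some (ex_minn h)
  | right _ => None
  end.

Definition payoff (S : set T) (f : T -> R) (w : Omega) : R :=
  if hitting_time S w is Some t then delta t * f (X t w) else 0.

Variable Q : R.-pker borel T ~> borel T.

Local Open Scope ereal_scope.

Definition continuation (x : T) (S : set T) (f : T -> R) : \bar R :=
  'E_(Prob Q x)[payoff S f].

Definition J (x : T) (S : set T) (f : T -> R) : \bar R :=
  if x \in S then (f x)%:E else continuation x S f.

Definition pseudo_equilibria (f : T -> R) (eps : R) : set (set T) :=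
  [set S | measurable (S : set (borel T)) /\
     forall x, ~ S x -> (f x)%:E <= continuation x S f + eps%:E].

Definition equilibria (f : T -> R) (eps : R) : set (set T) :=
  [set S | [/\ measurable (S : set (borel T)),
     forall x, ~ S x -> (f x)%:E <= continuation x S f + eps%:E &
     forall x, S x -> continuation x S f <= (f x)%:E + eps%:E]].

Definition V (eps : R) (x : T) (f : T -> R) : \bar R :=
  ereal_sup [set J x S f | S in equilibria f eps].

Definition W (eps : R) (x : T) (f : T -> R) : \bar R :=
  ereal_sup [set J x S f | S in pseudo_equilibria f eps].

End Markov.

Section Distances.
Context (R : realType).
Local Open Scope ereal_scope.

Definition sup_norm (T : Type) (f : T -> R) : \bar R :=
  ereal_sup (range (fun x => `|f x|%:E)).

(* Normalised so that g ranges over [0, 1]-valued functions; for probability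
   measures this is half of the total mass of the signed measure mu - nu. *)
Definition tv_dist (d : measure_display) (E : measurableType d)
    (mu nu : {measure set E -> \bar R}) : \bar R :=
  ereal_sup [set \int[mu]_y (g y)%:E - \int[nu]_y (g y)%:E |
    g in [set g : E -> R |
      measurable_fun setT g /\ forall y, (0 <= g y <= 1)%R]].

End Distances.

Definition reward (R : realType) (T : ptopologicalType) (f : T -> R) : Prop :=
  measurable_fun setT (f : borel T -> R) /\ forall x, 0 <= f x.

Record discount (R : realType) (delta : nat -> R) : Prop := Discount {
  discount_itv : forall t, 0 <= delta t <= 1;
  discount_noninc : forall s t, (s <= t)%N -> delta t <= delta s;
  discount0 : delta 0%N = 1;
  discount1 : delta 1%N < 1;
  discount_cvg : delta t @[t --> \oo] --> (0 : R) }.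

(* Main.v *)
Require Import Defs.
From HB Require Import structures.
From mathcomp Require Import all_boot all_order all_algebra.
From mathcomp Require Import all_classical all_reals all_analysis.
From mathcomp Require Import measurable_realfun ring lra.
Import Order.TTheory GRing.Theory Num.Theory.
Import numFieldNormedType.Exports.

(** The upper bound reduces, by uniform convergence of the continuation values
    over all target sets, to the claim that W_eps -> V_0 as eps -> 0 for the
    limit kernel.  Given pseudo 1/(k+1)-equilibria S_k, the inequality
    delta(s) delta(t) <= delta(s + t) lets one chase S_k and switch to another
    target S_j whenever S_k is hit outside S_j; over N steps each switch costs at
    most the error of S_j, and what happens after N steps is worth at most
    delta(N) M.  Hence the intersection of (S_k) for k >= m is at least as good
    as these S_k up to N/(m+1) + delta(N) M, and liminf S_k is a pseudo
    0-equilibrium.  Iteratively removing from it the points where continuing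
    beats stopping produces, in the limit, a genuine equilibrium of no smaller
    value. *)

Set Implicit Arguments.
Unset Strict Implicit.
Unset Printing Implicit Defensive.

Local Open Scope classical_set_scope.
Local Open Scope ring_scope.

(** * Integrals of bounded functions *)

Definition meas_bounded d (E : measurableType d) (R : realType) (M : R)
    (g : E -> R) : Prop :=
  measurable_fun setT g /\ forall z, 0 <= g z <= M.

Section ProbabilityIntegral.
Context d (E : measurableType d) (R : realType)
  (P : {measure set E -> \bar R}).
Hypothesis P1 : P setT = 1%E.
Implicit Types (g h : E -> R) (M c : R).

Lemma meas_bounded_integrable M g : meas_bounded M g ->
  P.-integrable setT (EFin \o g).
Proof.
move=> [mg g_bnd]; apply: measurable_bounded_integrable => //.
  by rewrite P1 ltry.
exists M; split; first exact: num_real.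

move=> x Mx z _ /=; have /andP[g0 gM] := g_bnd z.
by rewrite ger0_norm// (le_trans gM)// ltW.
Qed.

Lemma integrable_cst1 c : P.-integrable setT (EFin \o cst c).
Proof.
apply: measurable_bounded_integrable => //; last exact: bounded_cst.
by rewrite P1 ltry.
Qed.

Lemma Rintegral_prob_cst c : \int[P]_z c = c.
Proof. by rewrite Rintegral_cst// P1 mulr1. Qed.

(** Under a probability the constant [c] integrates to itself, so an additive error passes through
    one step of the recursion unchanged. *)
Lemma Rintegral_le_shift M N g h c : meas_bounded M g -> meas_bounded N h ->
  (forall z, g z <= h z + c) -> \int[P]_z g z <= \int[P]_z h z + c.
Proof.
move=> /meas_bounded_integrable ig /meas_bounded_integrable ih gh.
rewrite -[in leRHS](Rintegral_prob_cst c) -RintegralD//; last first.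
  exact: integrable_cst1.
apply: le_Rintegral => //.
exact: (integrableD measurableT ih (integrable_cst1 c)).
Qed.

Lemma Rintegral_le M N g h : meas_bounded M g -> meas_bounded N h ->
  (forall z, g z <= h z) -> \int[P]_z g z <= \int[P]_z h z.
Proof.
move=> bg bh gh; rewrite -[leRHS]addr0; apply: (Rintegral_le_shift bg bh) => z.
by rewrite addr0.
Qed.

Lemma Rintegral_itv M g : meas_bounded M g -> 0 <= \int[P]_z g z <= M.
Proof.
move=> bg; have [_ g_bnd] := bg; apply/andP; split.
  by apply: Rintegral_ge0 => z _; have /andP[] := g_bnd z.
rewrite -[leRHS]Rintegral_prob_cst; apply: le_Rintegral => //.
- exact: meas_bounded_integrable bg.
- exact: integrable_cst1.
- by move=> z _; have /andP[] := g_bnd z.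
Qed.

Lemma EFin_Rintegral M g : meas_bounded M g ->
  (\int[P]_z g z)%:E = (\int[P]_z (g z)%:E)%E.
Proof.
move=> /meas_bounded_integrable ig.
by rewrite fineK//; exact: integrable_fin_num ig.
Qed.

Lemma Rintegral_cvg M (g_ : nat -> E -> R) g :
  (forall n, meas_bounded M (g_ n)) -> meas_bounded M g ->
  (forall z, g_ n z @[n --> \oo] --> g z) ->
  \int[P]_z g_ n z @[n --> \oo] --> \int[P]_z g z.
Proof.
move=> bg_ bg gcvg.
suff /fine_cvgP[_] : (\int[P]_z (g_ n z)%:E)%E @[n --> \oo] -->
    (\int[P]_z g z)%:E by [].
rewrite (EFin_Rintegral bg).
have [|||||_ _ //] := @dominated_convergence _ _ _ P setT measurableT
  (fun n => EFin \o g_ n) (EFin \o g) (EFin \o cst M).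
- by move=> n; apply/measurable_EFinP; have [] := bg_ n.
- by apply/measurable_EFinP; have [] := bg.
- by apply/aeW => z _; apply: cvg_EFin; [exact: nearW|exact: gcvg].
- exact: integrable_cst1.
- apply/aeW => z n _ /=; have [_ /(_ z)/andP[g0 gM]] := bg_ n.
  by rewrite lee_fin ger0_norm.
Qed.

End ProbabilityIntegral.

(** * The finite-horizon recursion *)

Lemma measurable_in d (E : measurableType d) (S : set E) :
  measurable S -> measurable_fun setT (fun z => z \in S).
Proof.
move=> mS; apply: (measurable_fun_bool true); rewrite setTI.
rewrite (_ : _ @^-1` _ = S)//; apply/seteqP; split => z /=.
  exact: set_mem.
exact: mem_set.
Qed.

Section StopValue.
Context d (E : measurableType d) (R : realType) (delta : nat -> R).
Hypothesis delta_discount : discount delta.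

(* Expected payoff of stopping at the first visit to S, on a clock that already
   shows s, with a payoff of 0 when S is not reached within N steps. *)
Fixpoint stop_value (Q : R.-pker E ~> E) (f : E -> R) (S : set E) (N s : nat)
    (y : E) : R :=
  if N is N'.+1 then
    \int[Q y]_z (if z \in S then delta s.+1 * f z
                 else stop_value Q f S N' s.+1 z)
  else 0.

Lemma discount_ge0 s : 0 <= delta s.
Proof. by have /andP[] := discount_itv delta_discount s. Qed.

Lemma discount_le1 s : delta s <= 1.
Proof. by have /andP[] := discount_itv delta_discount s. Qed.

Lemma measurable_Rintegral_kernel (Q : R.-pker E ~> E) M g :
  meas_bounded M g -> measurable_fun setT (fun y => \int[Q y]_z g z).
Proof.
move=> [mg gM]; apply: measurableT_comp => //=.
apply: measurable_fun_integral_kernel => //=.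
- by move=> U mU; exact: measurable_kernel.
- by move=> z; rewrite lee_fin; have /andP[] := gM z.
- exact/measurable_EFinP.
Qed.

Section FixedKernel.
Variables (Q : R.-pker E ~> E) (M : R) (f : E -> R).
Hypothesis f_bnd : meas_bounded M f.
Implicit Types (S : set E).

Let D := stop_value Q f.

Let Q1 y : Q y setT = 1%E. Proof. exact: prob_kernel. Qed.

Let M_ge0 : 0 <= M.
Proof. by have [_ /(_ point)/andP[]] := f_bnd; exact: le_trans. Qed.

Let f_ge0 z : 0 <= f z. Proof. by have [_ /(_ z)/andP[]] := f_bnd. Qed.

Let f_leM z : f z <= M. Proof. by have [_ /(_ z)/andP[]] := f_bnd. Qed.

Lemma meas_bounded_stop S s L g : measurable S -> meas_bounded L g ->
  L <= delta s * M ->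
  meas_bounded (delta s * M) (fun z => if z \in S then delta s * f z else g z).
Proof.
move=> mS [mg gL] LM; split.
  apply: measurable_fun_ifT => //; first exact: measurable_in.
  by apply: measurable_funM => //; have [] := f_bnd.
move=> z; case: ifP => _.
  by rewrite mulr_ge0 ?discount_ge0// ler_wpM2l ?discount_ge0.
by have /andP[-> /le_trans] := gL z; exact.
Qed.

(** The factor [delta s] is available because a clock showing [s] only collects later payoffs and
    [delta] decreases; it is the source of the remainder [delta (s + N) * M] in
    [stop_value_switch]. *)
Lemma meas_bounded_stop_value S N s : measurable S ->
  meas_bounded (delta s * M) (D S N s).
Proof.
move=> mS; elim: N s => [|N IH] s /=.
  split; first exact: measurable_cst.
  by move=> z; apply/andP; split => //; rewrite mulr_ge0 ?discount_ge0.
have dM t : delta t.+1 * M <= delta t * M.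
  by rewrite ler_wpM2r// discount_noninc.
have bS := meas_bounded_stop mS (IH s.+1) (lexx _).
split; first exact: measurable_Rintegral_kernel bS.
by move=> y; have /andP[-> /le_trans] := Rintegral_itv (Q1 y) bS; exact.
Qed.

Let bS S N s (mS : measurable S) :=
  meas_bounded_stop mS (meas_bounded_stop_value N s.+1 mS) (lexx _).

Lemma stop_value_ge0 S N s y : measurable S -> 0 <= D S N s y.
Proof. by move=> /(meas_bounded_stop_value N s)[_ /(_ y)/andP[]]. Qed.

Lemma stop_value_le S N s y : measurable S -> D S N s y <= delta s * M.
Proof. by move=> /(meas_bounded_stop_value N s)[_ /(_ y)/andP[]]. Qed.

Lemma stop_value_step S N s y : measurable S -> D S N s y <= D S N.+1 s y.
Proof.
move=> mS; elim: N s y => [|N IH] s y; first exact: stop_value_ge0.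
apply: (Rintegral_le (Q1 y) (bS N s mS) (bS N.+1 s mS)) => z.
by case: ifP => // _; exact: IH.
Qed.

(** By induction on the horizon: where stopping occurs, the inequality is
    [delta s * delta t.+1 <= delta (s + t.+1)] times a nonnegative reward. It allows a target chosen
    afresh on clock 0 to be pursued on a running clock. *)
Lemma discount_mul_stop_value S N s t y :
  (forall i j, delta i * delta j <= delta (i + j)%N) -> measurable S ->
  delta s * D S N t y <= D S N (s + t) y.
Proof.
move=> dM mS; elim: N t y => [|N IH] t y; first by rewrite mulr0.
rewrite /D /= -RintegralZl//; last first.
  exact: (meas_bounded_integrable (Q1 y) (bS N t mS)).
have bs := bS N t mS.
apply: (@Rintegral_le _ _ _ _ (Q1 y) (delta s * (delta t.+1 * M))
  (delta (s + t).+1 * M)).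
- have [mg gM] := bs; split; first exact: measurable_funM.
  by move=> z; have /andP[? ?] := gM z;
     rewrite mulr_ge0 ?discount_ge0//= ler_wpM2l// discount_ge0.
- exact: bS.
- move=> z; rewrite -addnS; case: ifP => _; last exact: IH.
  by rewrite mulrA ler_wpM2r.
Qed.

(* Chasing S_ i and, on hitting a point z of S_ i outside S', switching to the
   target S_ j with f z <= D (S_ j) + e, costs at most e per switch, hence at
   most N e over N steps. *)
Lemma stop_value_switch (I : Type) (S_ : I -> set E) S' K (e : R) :
  (forall s t, delta s * delta t <= delta (s + t)%N) ->
  0 <= e -> (forall i, measurable (S_ i)) -> measurable S' ->
  (forall i, S' `<=` S_ i) ->
  (forall z, ~ S' z -> exists i, f z <= D (S_ i) K 0 z + e) ->
  forall N s i y,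
    D (S_ i) K s y <= D S' N s y + (N%:R * e + delta (s + N)%N * M).
Proof.
move=> dM e0 mS mS' S'S hS'; elim=> [|N IH] s i y.
  by rewrite mul0r !add0r addn0 stop_value_le.
(* Raising the horizon to [K.+1] pays for the step about to be unfolded, so that the induction
   hypothesis and [hS'] apply with the same [K]. *)
rewrite (le_trans (stop_value_step K s y (mS i)))//.
apply: (Rintegral_le_shift (Q1 y) (bS K s (mS i)) (bS N s mS')) => z.
have c0 : 0 <= N.+1%:R * e + delta (s + N.+1)%N * M.
  by rewrite addr_ge0// mulr_ge0// discount_ge0.
have le_c : N%:R * e + delta (s.+1 + N)%N * M + e =
            N.+1%:R * e + delta (s + N.+1)%N * M.
  by rewrite addSnnS -natr1; ring.
have [zS'|zS'] := boolP (z \in S').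
  have -> : z \in S_ i by apply/mem_set/S'S/set_mem.
  by rewrite lerDl.
case: ifP => _; last first.
  by rewrite (le_trans (IH s.+1 i z))// lerD2l -le_c lerDl.
have [|j fz] := hS' z; first by move/mem_set; exact/negP.
rewrite -le_c [leRHS]addrA.
apply: (@le_trans _ _ (D (S_ j) K s.+1 z + e)); last by rewrite lerD2r IH.
(* The switch: stopping at [z] is traded for pursuing [S_ j], whose clock is moved from 0 to [s.+1];
   since [delta <= 1], the error stays below [e]. *)
rewrite (le_trans (ler_wpM2l (discount_ge0 _) fz))// mulrDr lerD//.
  by have := discount_mul_stop_value K s.+1 0 z dM (mS j); rewrite addn0.
by rewrite ler_piMl// discount_le1.
Qed.

(** By induction on the horizon, the integrands converge pointwise because membership of each [z] is
    eventually constant; dominated convergence does the rest. *)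
Lemma stop_value_cvg (S_ : nat -> set E) S N s y :
  (forall m, measurable (S_ m)) -> measurable S ->
  (forall z, \forall m \near \oo, (z \in S_ m) = (z \in S)) ->
  D (S_ m) N s y @[m --> \oo] --> D S N s y.
Proof.
move=> mS_ mS S_S; elim: N s y => [|N IH] s y; first exact: cvg_cst.
apply: (Rintegral_cvg (Q1 y) (fun m => bS N s (mS_ m)) (bS N s mS)) => z.
rewrite -/(D S N s.+1); have := IH s.+1 z; case: ifPn => zS IHz.
  apply: cvg_near_cst; near=> m.
  by rewrite (_ : z \in S_ m)//; near: m; apply: filterS (S_S z) => m ->.
apply: cvg_trans IHz; apply: near_eq_cvg; near=> m.
rewrite ifN//; near: m; apply: filterS (S_S z) => m ->//.
Unshelve. all: by end_near. Qed.

End FixedKernel.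
End StopValue.

(** * Disintegration along one step of the process *)

Section Disintegration.
Context d d' (O : measurableType d) (E : measurableType d') (R : realType).
Context (P : probability O R) (A : set O) (mA : measurable A).
Context (X Y : {mfun O >-> E}) (Q : R.-pker E ~> E).

(** The restriction of [P] to [A] is viewed as a kernel from a point, and [Q (X w)] as a kernel
    depending on [w], so that their composition is the law of [Y] on [A]. *)
Let l (_ : unit) : {measure set O -> \bar R} := mrestr P mA.
Let k (p : unit * O) : {measure set E -> \bar R} := Q (X p.2).

Let measurable_l U : measurable U -> measurable_fun setT (l ^~ U).
Proof. by move=> _; exact: measurable_cst. Qed.

Let measurable_k U : measurable U -> measurable_fun setT (k ^~ U).
Proof.
move=> mU; apply: (measurableT_comp (measurable_kernel Q U mU)).
exact: (measurableT_comp (@measurable_funPT _ _ _ _ X) measurable_snd).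
Qed.

HB.instance Definition _ := isKernel.Build _ _ _ _ _ l measurable_l.
HB.instance Definition _ := isKernel.Build _ _ _ _ _ k measurable_k.

Let l_uub : measure_fam_uub l.
Proof.
exists 2 => p; apply: (@le_lt_trans _ _ 1%E); last by rewrite lte_fin ltr1n.
by apply: probability_le1; exact: measurableI.
Qed.

Let k_uub : measure_fam_uub k.
Proof.
exists 2 => p; rewrite [ltLHS](prob_kernel (s := Q)).
by rewrite lte_fin ltr1n.
Qed.

HB.instance Definition _ := Kernel_isFinite.Build _ _ _ _ _ l l_uub.
HB.instance Definition _ := Kernel_isFinite.Build _ _ _ _ _ k k_uub.

(** The hypothesis says that the image under [Y] of [P] restricted to [A] is the composition of [l]
    and [k]; integrating [f] against both measures gives the two sides. *)
Lemma integral_disintegration (f : E -> \bar R) :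
  (forall B, measurable B ->
    P (A `&` Y @^-1` B) = (\int[P]_(w in A) Q (X w) B)%E) ->
  (forall z, 0 <= f z)%E -> measurable_fun setT f ->
  (\int[P]_(w in A) f (Y w) = \int[P]_(w in A) \int[Q (X w)]_z f z)%E.
Proof.
move=> PQ f0 mf.
have restrE g : measurable_fun setT g -> (forall w, 0 <= g w)%E ->
    (\int[mrestr P mA]_w g w = \int[P]_(w in A) g w)%E.
  move=> mg g0.
  rewrite (ge0_negligible_integral (measurableC mA) measurableT)//; last first.
    by rewrite /= /mrestr setICl measure0.
  rewrite setTD setCK; apply: eq_measure_integral => U mU UA.
  by rewrite /= /mrestr setIidl.
rewrite -[RHS]restrE; last 2 first.
- apply: (measurableT_comp (measurable_fun_integral_kernel _ f0 mf)) => //.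
  exact: measurable_kernel.
- by move=> w; exact: integral_ge0.
have := integral_kcomp l k tt f0 mf.
rewrite /= => <-.
rewrite -[LHS]restrE; last 2 first.
- exact: measurableT_comp.
- by move=> w; exact: f0.
rewrite -[X in integral _ X _](@preimage_setT _ _ Y).
rewrite -[LHS](ge0_integral_pushforward _ _ measurableT mf)//.
apply: eq_measure_integral => B mB _.
rewrite /= /kcomp /pushforward /= /mrestr setIC PQ//.
rewrite restrE//.
exact: (measurableT_comp (measurable_kernel Q B mB)).
Qed.
End Disintegration.

(** * Identification with the expected payoff *)

Section Payoff.
Context (R : realType) (T : ptopologicalType).
Context (dO : measure_display) (Omega : measurableType dO).
Context (X : nat -> {mfun Omega >-> borel T}) (delta : nat -> R).
Hypothesis delta_discount : discount delta.
Context (M : R) (f : borel T -> R) (f_bnd : meas_bounded M f).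
Context (S : set (borel T)) (mS : measurable S).

(** Pathwise counterpart of [stop_value]: by [integral_truncated_payoff], [stop_value] evaluated at
    [X s] is its conditional expectation given the history up to [s]. *)
Fixpoint truncated_payoff (N s : nat) (w : Omega) : R :=
  if N is N'.+1 then
    if X s.+1 w \in S then delta s.+1 * f (X s.+1 w)
    else truncated_payoff N' s.+1 w
  else 0.

Let f_ge0 z : 0 <= f z. Proof. by have [_ /(_ z)/andP[]] := f_bnd. Qed.

Let f_leM z : f z <= M. Proof. by have [_ /(_ z)/andP[]] := f_bnd. Qed.

Let delta_ge0 t : 0 <= delta t. Proof. exact: discount_ge0. Qed.

Let delta_le1 t : delta t <= 1. Proof. exact: discount_le1. Qed.

Let M_ge0 : 0 <= M. Proof. exact: le_trans (f_ge0 point) (f_leM point). Qed.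

Lemma truncated_payoff_hit k N s w : (s < k <= s + N)%N -> X k w \in S ->
  (forall j, (s < j < k)%N -> X j w \notin S) ->
  truncated_payoff N s w = delta k * f (X k w).
Proof.
elim: N s => [|N IH] s.
  by rewrite addn0 => /andP[/leq_trans/[apply]]; rewrite ltnn.
rewrite -addSnnS => /andP[] + kN kS firstk /=.
rewrite leq_eqVlt => /predU1P[->|sk]; first by rewrite kS.
rewrite ifN ?firstk ?ltnSn//; apply: IH => //; first exact/andP.
by move=> j /andP[sj jk]; rewrite firstk// jk (ltnW sj).
Qed.

Lemma truncated_payoff_miss N s w :
  (forall j, (s < j <= s + N)%N -> X j w \notin S) ->
  truncated_payoff N s w = 0.
Proof.
elim: N s => [//|N IH] s miss /=.
rewrite ifN ?miss ?ltnSn ?addnS ?ltnS ?leq_addr//.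
apply: IH => j /andP[sj jN]; apply: miss.
by rewrite (ltnW sj) addnS -addSn.
Qed.

(** The two payoffs differ only if the first visit comes after time [N], and such a visit pays at
    most [delta N * M]. *)
Lemma truncated_payoff_bounds N w :
  truncated_payoff N 0 w <= payoff X delta S f w <=
  truncated_payoff N 0 w + delta N * M.
Proof.
have M0 : 0 <= delta N * M by rewrite mulr_ge0 ?delta_ge0.
rewrite /payoff /hitting_time; case: pselect => [h|h] /=; last first.
  rewrite truncated_payoff_miss ?lexx ?add0r//.
  by move=> j /andP[j0 _]; apply/negP => jS; apply: h; exists j; rewrite j0.
case: ex_minnP => t /andP[t1 tS] min_t.
have firstt j : (0 < j < t)%N -> X j w \notin S.
  move=> /andP[j0 jt]; apply/negP => jS.
  by have := min_t j; rewrite j0 jS leqNgt jt => /(_ isT).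
have [tN|Nt] := leqP t N.
  by rewrite (@truncated_payoff_hit t) ?t1//= lexx lerDl.
rewrite truncated_payoff_miss ?add0r; last first.
  by move=> j /andP[j0 jN]; rewrite firstt// j0 (leq_ltn_trans jN).
rewrite mulr_ge0 ?delta_ge0//= ler_pM ?delta_ge0//.
exact: (discount_noninc delta_discount (ltnW Nt)).
Qed.

Lemma meas_bounded_truncated_payoff N s :
  meas_bounded M (truncated_payoff N s).
Proof.
have [mf _] := f_bnd.
have mX t : measurable_fun setT (X t) by exact: measurable_funPT.
elim: N s => [|N IH] s /=.
  by split; [exact: measurable_cst|move=> z; apply/andP].
have [mN N_bnd] := IH s.+1; split.
  apply: measurable_fun_ifT => //.
    exact: (measurableT_comp (measurable_in mS) (mX _)).
  by apply: measurable_funM => //; exact: (measurableT_comp mf (mX _)).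
move=> w; case: ifP => // _; rewrite mulr_ge0 ?delta_ge0//=.
by rewrite (le_trans _ (f_leM (X s.+1 w)))// ler_piMl// delta_le1.
Qed.

Lemma meas_bounded_payoff : meas_bounded M (payoff X delta S f).
Proof.
have tb N := meas_bounded_truncated_payoff N 0.
split.
  apply: (@measurable_fun_cvg _ _ _ _ (fun N => truncated_payoff N 0)).
    by move=> N; have [] := tb N.
  move=> w _.
  apply: (@squeeze_cvgr _ _ _ _ (fun N => payoff X delta S f w - delta N * M)
    (fun=> payoff X delta S f w)); last exact: cvg_cst.
    apply: nearW => N; have /andP[? ?] := truncated_payoff_bounds N w.
    by rewrite lerBlDr; apply/andP.
  rewrite -[X in _ --> X]subr0 -[X in _ - X](mul0r M).
  apply: cvgB; first exact: cvg_cst.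
  by apply: cvgM; [exact: discount_cvg|exact: cvg_cst].
(* At horizon 0 the truncated payoff is 0 and [delta 0 = 1], so the bounds become 0 and [M]. *)
move=> w; have /andP[le0 _] := truncated_payoff_bounds 0 w; rewrite le0/=.
have /andP[_] := truncated_payoff_bounds 0 w; rewrite add0r.
by rewrite discount0// mul1r.
Qed.

Section Markov.
Context (Q : R.-pker borel T ~> borel T) (x : T) (P : probability Omega R).
Hypothesis markovP : is_markov X Q x P.
Hypothesis mx : measurable ([set x] : set (borel T)).

Let F t := natural_filtration X t.

Lemma natural_filtration_measurable t A : F t A -> measurable A.
Proof.
apply: smallest_sub; first exact: sigma_algebra_measurable.
move=> _ [i [B [_ mB ->]]]; rewrite -[_ @^-1` _]setTI.
by apply: measurable_funPT.
Qed.

Lemma natural_filtration_step t A : F t A -> F t.+1 (A `&` X t.+1 @^-1` ~` S).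
Proof.
move=> FA.
have FA1 : F t.+1 A.
  apply: (sub_smallest2r _ _ FA); first exact: smallest_sigma_algebra.
  by move=> _ [i [B [it mB ->]]]; exists i, B; split => //; exact: leqW.
have FB : F t.+1 (X t.+1 @^-1` ~` S).
  apply: sub_gen_smallest; exists t.+1, (~` S).
  by split => //; exact: measurableC.
exact: (@measurableI _ (g_sigma_algebraType _) _ _ FA1 FB).
Qed.

(** The event [A] of the past is arbitrary because the induction restricts it to the paths that miss
    [S] at time [t.+1], which is an event of [F t.+1]. *)
Lemma integral_truncated_payoff N t A : F t A ->
  (\int[P]_(w in A) (truncated_payoff N t w)%:E =
   \int[P]_(w in A) (stop_value delta Q f S N t (X t w))%:E)%E.
Proof.
elim: N t A => [//|N IH] t A FA.
have mA := natural_filtration_measurable FA.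
have [_ mkv] := markovP.
have mX s : measurable_fun setT (X s) by exact: measurable_funPT.
set B := X t.+1 @^-1` S.
have mB : measurable B by rewrite -[B]setTI; exact: mX.
have bN := meas_bounded_stop_value delta_discount Q f_bnd N t.+1 mS.
have b := meas_bounded_stop delta_discount f_bnd mS bN (lexx _).
have [mb b_bnd] := b.
pose g z := if z \in S then delta t.+1 * f z
            else stop_value delta Q f S N t.+1 z.
transitivity (\int[P]_(w in A) (g (X t.+1 w))%:E)%E; last first.
  rewrite (@integral_disintegration _ _ _ _ _ P A mA (X t) (X t.+1) Q
    (EFin \o g)).
  - apply: eq_integral => w _.
    by rewrite -(EFin_Rintegral (prob_kernel _) b).
  - by move=> U mU; exact: mkv.
  - by move=> z; rewrite lee_fin; have /andP[] := b_bnd z.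
  - exact/measurable_EFinP.
(* On the paths that hit [S] at [t.+1] the integrands coincide; on the others the induction
   hypothesis applies from time [t.+1]. *)
have AE : A = (A `&` B) `|` (A `\` B) by rewrite setUIDK.
have [mtp tp_bnd] := meas_bounded_truncated_payoff N.+1 t.
have disj : [disjoint (A `&` B) & (A `\` B)].
  by apply/disj_setPS => w [[_ ?] []].
have mAB : measurable (A `&` B) by exact: measurableI.
have mADB : measurable (A `\` B) by exact: measurableD.
rewrite AE !ge0_integral_setU//; first last.
- by move=> w _; rewrite lee_fin; have /andP[] := tp_bnd w.
- by apply: measurable_funTS; exact/measurable_EFinP.
- by move=> w _; rewrite lee_fin; have /andP[] := b_bnd (X t.+1 w).
- apply: measurable_funTS; apply/measurable_EFinP.
  exact: (measurableT_comp mb (mX t.+1)).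
congr (_ + _)%E.
  by apply: eq_integral => w /set_mem[_ wB] /=; rewrite /g !ifT// mem_set.
have notS w : w \in A `\` B -> X t.+1 w \notin S.
  by move=> /set_mem[_ wB]; apply/negP => /set_mem.
transitivity (\int[P]_(w in A `\` B) (truncated_payoff N t.+1 w)%:E)%E.
  by apply: eq_integral => w /notS wS /=; rewrite ifN.
rewrite IH; last exact: natural_filtration_step.
by apply: eq_integral => w /notS wS /=; rewrite /g ifN.
Qed.

(** This is the trivial event at time 0: the process starts at [x] almost surely, so the integrand
    is almost surely constant. *)
Lemma stop_value_expectation N :
  (\int[P]_w (truncated_payoff N 0 w)%:E = (stop_value delta Q f S N 0 x)%:E)%E.
Proof.
have FT : F 0 setT by exact: (@measurableT _ (g_sigma_algebraType _)).
rewrite (integral_truncated_payoff N FT).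
have [X0 _] := markovP.
set A := _ @^-1` _ in X0.
have mA : measurable A by rewrite -[A]setTI; exact: measurable_funPT.
have [mD D_bnd] := meas_bounded_stop_value delta_discount Q f_bnd N 0 mS.
have PA0 : P (~` A) = 0%E by rewrite probability_setC// X0 subee.
rewrite (ge0_negligible_integral (measurableC mA) measurableT)//; first last.
- by move=> w _; rewrite lee_fin; have /andP[] := D_bnd (X 0%N w).
- apply/measurable_EFinP; apply: (measurableT_comp mD).
  exact: measurable_funPT.
rewrite setTD setCK.
under eq_integral => w /set_mem -> do over.
by rewrite integral_cst// [X in (_ * X)%E]X0 mule1.
Qed.

(** The later arguments see the process only through these bounds, which reappear as the hypothesis
    [c_bounds]. *)
Lemma expectation_payoff_bounds N :
  exists2 c : R, ('E_P[payoff X delta S f] = c%:E)%E &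
    stop_value delta Q f S N 0 x <= c <=
    stop_value delta Q f S N 0 x + delta N * M.
Proof.
have P1 : P setT = 1%E by exact: probability_setT.
exists (\int[P]_w payoff X delta S f w).
  by rewrite unlock (EFin_Rintegral P1 meas_bounded_payoff).
have tb := meas_bounded_truncated_payoff N 0.
have -> : stop_value delta Q f S N 0 x = \int[P]_w truncated_payoff N 0 w.
  by rewrite /Rintegral stop_value_expectation.
have pb := truncated_payoff_bounds N.
apply/andP; split.
  apply: (Rintegral_le P1 tb meas_bounded_payoff) => w.
  by have /andP[] := pb w.
apply: (Rintegral_le_shift P1 meas_bounded_payoff tb) => w.
by have /andP[] := pb w.
Qed.

End Markov.
End Payoff.

(** * Pseudo-equilibria and equilibria for a fixed kernel *)

Lemma le_cvg_vanishing (R : realType) (a b C : R) (u e : nat -> R) :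
  u @ \oo --> b -> e @ \oo --> 0 ->
  (\forall m \near \oo, a <= u m + C * e m) -> a <= b.
Proof.
move=> ub e0 aue.
have ueb : u m + C * e m @[m --> \oo] --> b.
  rewrite -[b]addr0 -[X in _ + X](mulr0 C).
  by apply: cvgD => //; exact: cvgMr.
rewrite -(cvg_lim _ ueb)//; apply: limr_ge => //.
by apply/cvg_ex; exists b.
Qed.

Lemma near_in_bigcap (E : Type) (S_ : nat -> set E) :
  (forall n, S_ n.+1 `<=` S_ n) ->
  forall z, \forall m \near \oo, (z \in S_ m) = (z \in \bigcap_n S_ n).
Proof.
move=> S_dec z; have S_le m k : S_ (m + k)%N `<=` S_ m.
  elim: k => [|k IH]; rewrite ?addn0// addnS.
  exact: subset_trans (S_dec _) IH.
have [Sz|nSz] := pselect ((\bigcap_n S_ n) z).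
  by apply: nearW => m; rewrite !mem_set//; exact: Sz.
have /existsNP[n /not_implyP[_ Snz]] := nSz.
exists n => // m /= nm; rewrite !memNset// -(subnKC nm).
by move=> /S_le.
Qed.

Lemma near_in_bigcup (E : Type) (S_ : nat -> set E) :
  (forall n, S_ n `<=` S_ n.+1) ->
  forall z, \forall m \near \oo, (z \in S_ m) = (z \in \bigcup_n S_ n).
Proof.
move=> S_inc z; have S_le m k : S_ m `<=` S_ (m + k)%N.
  elim: k => [|k IH]; rewrite ?addn0// addnS.
  exact: subset_trans IH (S_inc _).
have [[n _ Snz]|nSz] := pselect ((\bigcup_n S_ n) z).
  exists n => // m /= nm.
  have Smz : S_ m z by rewrite -(subnKC nm); exact: S_le.
  by rewrite !mem_set//; exists n.
by apply: nearW => m; rewrite !memNset// => Sz; apply: nSz; exists m.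
Qed.

Section ContinuationValue.
Context d (E : measurableType d) (R : realType) (delta : nat -> R).
Hypothesis delta_discount : discount delta.
Variables (Q : R.-pker E ~> E) (M : R) (f : E -> R).
Hypothesis f_bnd : meas_bounded M f.
Variable c : set E -> E -> R.
Hypothesis c_bounds : forall S N y, measurable S ->
  stop_value delta Q f S N 0 y <= c S y <=
  stop_value delta Q f S N 0 y + delta N * M.
Implicit Types (S : set E) (x y z : E).

Let delta0 : delta n @[n --> \oo] --> 0. Proof. exact: discount_cvg. Qed.

Lemma continuation_cvg (S_ : nat -> set E) S y :
  (forall m, measurable (S_ m)) -> measurable S ->
  (forall z, \forall m \near \oo, (z \in S_ m) = (z \in S)) ->
  c (S_ m) y @[m --> \oo] --> c S y.
Proof.
move=> mS_ mS S_S; apply/cvgrPdist_le => e e0.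
(* Two halves suffice because the truncation error has a fixed sign: one half is for the horizon,
   the other for the convergence of the truncated values. *)
have e3 : 0 < e / 2 by rewrite divr_gt0.
have dM0 : delta N * M @[N --> \oo] --> 0.
  by rewrite -(mul0r M); apply: cvgM => //; exact: cvg_cst.
have [N _ /(_ N (leqnn N)) dN] := (cvgrPdist_le _ _).1 dM0 _ e3.
have := @stop_value_cvg _ _ _ _ delta_discount Q _ _ f_bnd _ _ N 0%N y
  mS_ mS S_S.
move=> /cvgrPdist_le/(_ _ e3); apply: filterS => m.
have /andP[l1 u1] := c_bounds N y (mS_ m).
have /andP[l2 u2] := c_bounds N y mS.
rewrite sub0r normrN in dN.
move: dN; rewrite !ler_norml => /andP[_ dN] /andP[? ?].
by apply/andP; split; lra.
Qed.

Lemma measurable_continuation S : measurable S -> measurable_fun setT (c S).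
Proof.
move=> mS.
apply: (@measurable_fun_cvg _ _ _ _ (fun N => stop_value delta Q f S N 0)).
  by move=> N; have [] := meas_bounded_stop_value delta_discount Q f_bnd N 0 mS.
move=> y _.
apply: (@squeeze_cvgr _ _ _ _ (fun N => c S y - delta N * M) (fun=> c S y)).
- apply: nearW => N; have /andP[? ?] := c_bounds N y mS.
  by rewrite lerBlDr; apply/andP.
- rewrite -[X in _ --> X]subr0 -[X in _ - X](mul0r M).
  by apply: cvgB; [exact: cvg_cst|apply: cvgM => //; exact: cvg_cst].
- exact: cvg_cst.
Qed.

Hypothesis delta_mul : forall s t, delta s * delta t <= delta (s + t)%N.

Lemma continuation_switch (I : Type) (S_ : I -> set E) S' (e : R) :
  0 <= e -> (forall i, measurable (S_ i)) -> measurable S' ->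
  (forall i, S' `<=` S_ i) ->
  (forall z, ~ S' z -> exists i, f z <= c (S_ i) z + e) ->
  forall N i y, c (S_ i) y <= c S' y + (N%:R * e + delta N * M).
Proof.
move=> e0 mS mS' S'S hS' N i y.
have M0 : 0 <= M by have [_ /(_ point)/andP[]] := f_bnd; exact: le_trans.
(* The horizon [K] of the truncated values tends to infinity. Its error [delta K * M] enters [N]
   times through the switches and once more in truncating [c (S_ i)]. *)
apply: (@le_cvg_vanishing _ _ _ (N.+1%:R * M)
  (fun=> c S' y + (N%:R * e + delta N * M)) delta) => //; first exact: cvg_cst.
apply: nearW => K.
have eK : 0 <= e + delta K * M by rewrite addr_ge0// mulr_ge0// discount_ge0.
have hK z : ~ S' z -> exists i,
    f z <= stop_value delta Q f (S_ i) K 0 z + (e + delta K * M).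
  move=> /hS'[j fz]; exists j; have /andP[_ cK] := c_bounds K z (mS j).
  by lra.
have := stop_value_switch delta_discount f_bnd delta_mul eK mS mS' S'S hK
  N 0 i y.
rewrite add0n.
have /andP[_ cK] := c_bounds K y (mS i).
have /andP[cN _] := c_bounds N y mS'.
rewrite -natr1; nra.
Qed.

Let j S x := if x \in S then f x else c S x.

(* S = liminf S_ k: the tails \bigcap_(k >= m) S_ k increase to S. *)
Lemma pseudo_equilibrium_limit (S_ : nat -> set E) x r :
  (forall k, measurable (S_ k)) ->
  (forall k z, ~ S_ k z -> f z <= c (S_ k) z + k.+1%:R^-1) ->
  (forall k, r <= j (S_ k) x) ->
  exists S, [/\ measurable S, forall z, ~ S z -> f z <= c S z & r <= j S x].
Proof.
move=> mS_ pS_ rS_.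
pose A m := \bigcap_i S_ (m + i)%N.
have mA m : measurable (A m) by apply: bigcap_measurable => // i _.
have AS m : A m `<=` A m.+1.
  by move=> z Az i _; rewrite addSnnS; exact: Az.
have mU : measurable (\bigcup_m A m) by exact: bigcup_measurable.
have A_cvg y : c (A m) y @[m --> \oo] --> c (\bigcup_m A m) y.
  by apply: continuation_cvg => //; exact: near_in_bigcup.
have inv0 : k.+1%:R^-1 @[k --> \oo] --> (0 : R).
  exact: cvg_harmonic.
have notA y m : ~ (\bigcup_m A m) y -> exists i, ~ S_ (m + i)%N y.
  move=> Uy; apply: contrapT => /forallNP Sy; apply: Uy; exists m => // i _.
  exact: (contrapT (Sy i)).
have inv_le m i : (m + i).+1%:R^-1 <= m.+1%:R^-1 :> R.
  by rewrite lef_pV2 ?posrE// ler_nat ltnS leq_addr.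
have AV m i y N :
    c (S_ (m + i)%N) y <= c (A m) y + (N%:R * m.+1%:R^-1 + delta N * M).
  apply: (@continuation_switch _ (fun i => S_ (m + i)%N) (A m)
    m.+1%:R^-1) => //.
  - by move=> k z; exact.
  - move=> z /existsNP[k /not_implyP[_ Sz]]; exists k.
    by rewrite (le_trans (pS_ _ _ Sz))// lerD2l.
(* A point outside the liminf lies, for each [m], outside some [S_ (m + i)]. With [N] fixed, letting
   [m] grow removes the switching errors; then letting [N] grow removes [delta N * M]. *)
have lim_le a y : ~ (\bigcup_m A m) y ->
    (forall m i, ~ S_ (m + i)%N y ->
      a <= c (S_ (m + i)%N) y + (m + i).+1%:R^-1) ->
    a <= c (\bigcup_m A m) y.
  move=> Uy ay.
  apply: (@le_cvg_vanishing _ _ _ M (fun=> c (\bigcup_m A m) y) delta) => //.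
    exact: cvg_cst.
  apply: nearW => N.
  (* The error [m.+1%:R^-1] occurs [N] times in [AV] and once in [ay]. *)
  apply: (@le_cvg_vanishing _ _ _ N.+1%:R
    (fun m => c (A m) y + M * delta N) (fun m => m.+1%:R^-1)) => //.
    by apply: cvgD => //; exact: cvg_cst.
  apply: nearW => m; have [i Sy] := notA y m Uy.
  have := ay m i Sy; have := AV m i y N; have := inv_le m i.
  rewrite -[N.+1%:R]natr1.
  move: (_^-1) (_^-1) => e1 e2; nra.
exists (\bigcup_m A m); split => //.
  by move=> z Uz; apply: lim_le => // m i; exact: pS_.
rewrite /j; case: ifPn => [/set_mem[m _ Am]|/negP xU].
  by have := rS_ (m + 0)%N; rewrite /j mem_set//; exact: Am.
apply: lim_le => [Ux|m i Sx]; first by apply: xU; exact: mem_set.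
have := rS_ (m + i)%N; rewrite /j ifN; last by apply/negP => /set_mem.
by move=> /le_trans; apply; rewrite lerDl.
Qed.

(* The witness is the intersection of the decreasing sequence obtained by
   discarding, at each stage, the points where continuing beats stopping. *)
Lemma equilibrium_of_pseudo S0 x :
  measurable S0 -> (forall z, ~ S0 z -> f z <= c S0 z) ->
  exists S, [/\ measurable S, forall z, ~ S z -> f z <= c S z,
    forall z, S z -> c S z <= f z & j S0 x <= j S x].
Proof.
move=> mS0 pS0.
pose A n := iter n (fun S => S `&` [set y | c S y <= f y]) S0.
have A_dec n : A n.+1 `<=` A n by move=> z [].
have [mf _] := f_bnd.
have mA n : measurable (A n).
  elim: n => [//|n mAn]; apply: measurableI => //.
  have /(_ measurableT [set true] I) :=
    measurable_fun_ler (measurable_continuation mAn) mf.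
  rewrite setTI; congr measurable; apply/seteqP; by split.
(* Switching with the single target [A n] and zero error: a point outside [A n.+1] is either outside
   [A n] or was discarded because continuing is strictly better, so [f <= c (A n)] there. *)
have A_step n y : (forall z, ~ A n z -> f z <= c (A n) z) ->
    c (A n) y <= c (A n.+1) y.
  move=> pn.
  apply: (@le_cvg_vanishing _ _ _ M (fun=> c (A n.+1) y) delta) => //.
    exact: cvg_cst.
  apply: nearW => N.
  have := @continuation_switch unit (fun=> A n) (A n.+1) 0 (lexx _)
    (fun=> mA n) (mA n.+1) (fun=> A_dec n).
  have h z : ~ A n.+1 z -> exists _ : unit, f z <= c (A n) z + 0.
    move=> Az; exists tt; rewrite addr0.
    have [Anz|/pn//] := pselect (A n z).
    by rewrite leNgt; apply/negP => /ltW cf; apply: Az; split.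
  by move=> /(_ h N tt y); rewrite mulr0 add0r [delta N * M]mulrC.
have pA n z : ~ A n z -> f z <= c (A n) z.
  elim: n z => [//|n IH] z Az.
  have [Anz|nAnz] := pselect (A n z); last first.
    by rewrite (le_trans (IH _ nAnz))//; exact: A_step.
  rewrite (le_trans _ (A_step n z IH))// leNgt; apply/negP => /ltW cf.
  by apply: Az; split.
have c_inc n y : c (A n) y <= c (A n.+1) y by apply: A_step; exact: pA.
pose S := \bigcap_n A n.
have mS : measurable S by exact: bigcap_measurable.
have A_cvg y : c (A n) y @[n --> \oo] --> c S y.
  by apply: continuation_cvg => //; exact: near_in_bigcap.
have cAS n y : c (A n) y <= c S y.
  rewrite -(cvg_lim _ (A_cvg y))//; apply: nondecreasing_cvgn_le.
    by apply/nondecreasing_seqP => m; exact: c_inc.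
  by apply/cvg_ex; exists (c S y).
have pS z : ~ S z -> f z <= c S z.
  by move=> /existsNP[n /not_implyP[_ Az]]; rewrite (le_trans (pA _ _ Az)).
exists S; split => //.
(* Surviving in [A n.+1] means passing the test [c (A n) z <= f z]; this holds for every [n] and
   passes to the limit. *)
- move=> z Sz; rewrite -(cvg_lim _ (A_cvg z))//; apply: limr_le.
    by apply/cvg_ex; exists (c S z).
  by apply: nearW => n; have [] := Sz n.+1 I.
- rewrite /j; case: (boolP (x \in S)) => [xS|/negP xS].
    by rewrite mem_set//; exact: (set_mem xS 0%N I).
  case: ifP => xS0; last exact: (cAS 0%N).
  by apply: pS => Sx; apply: xS; exact: mem_set.
Qed.

End ContinuationValue.

(** * Perturbation of the kernel and the reward *)

Lemma Rintegral_le_scale d (E : measurableType d) (R : realType)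
    (P P' : {measure set E -> \bar R}) (M eta : R) g :
  P setT = 1%E -> P' setT = 1%E -> 0 < M ->
  (forall h, meas_bounded 1 h -> \int[P]_z h z <= \int[P']_z h z + eta) ->
  meas_bounded M g -> \int[P]_z g z <= \int[P']_z g z + M * eta.
Proof.
move=> P1 P'1 M0 PP' [mg gM].
have gE z : g z = M * (g z / M) by rewrite mulrCA mulfV ?mulr1// gt_eqF.
have bg : meas_bounded 1 (fun z => g z / M).
  split; first exact: measurable_funM.
  move=> z; have /andP[? ?] := gM z.
  by rewrite divr_ge0 ?(ltW M0)//= ler_pdivrMr// mul1r.
have scale (m : {measure set E -> \bar R}) : m setT = 1%E ->
    \int[m]_z g z = M * \int[m]_z (g z / M).
  move=> m1; rewrite -RintegralZl//; last first.
    exact: (meas_bounded_integrable m1 bg).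
  by apply: eq_Rintegral => z _; exact: gE.
by rewrite !scale// -mulrDr ler_pM2l// PP'.
Qed.

(** Each of the [N] kernel replacements costs [M * eta], whereas [kappa] is paid only once, since a
    path collects at most one reward. The bound does not depend on [S]. *)
Lemma stop_value_perturb d (E : measurableType d) (R : realType)
    (delta : nat -> R) (Q Q' : R.-pker E ~> E) (M M' : R) (f f' : E -> R)
    (eta kappa : R) (S : set E) :
  discount delta -> 0 < M -> meas_bounded M f -> meas_bounded M' f' ->
  0 <= eta -> 0 <= kappa ->
  (forall g y, meas_bounded 1 g ->
    \int[Q y]_z g z <= \int[Q' y]_z g z + eta) ->
  (forall z, f z <= f' z + kappa) -> measurable S ->
  forall N s y, stop_value delta Q f S N s y <=
    stop_value delta Q' f' S N s y + (N%:R * (M * eta) + kappa).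
Proof.
move=> dd M0 bf bf' eta0 kappa0 QQ' ff' mS; elim=> [|N IH] s y.
  by rewrite /= mul0r !add0r.
have b := meas_bounded_stop dd bf mS
  (meas_bounded_stop_value dd Q bf N s.+1 mS) (lexx _).
have b' := meas_bounded_stop dd bf' mS
  (meas_bounded_stop_value dd Q' bf' N s.+1 mS) (lexx _).
have bM : meas_bounded M (fun z => if z \in S then delta s.+1 * f z
                                   else stop_value delta Q f S N s.+1 z).
  have [mg g_bnd] := b; split => // z; have /andP[-> /le_trans] := g_bnd z.
  by apply; rewrite ler_piMl ?(ltW M0)// discount_le1.
have Q1 := prob_kernel (s := Q) y; have Q'1 := prob_kernel (s := Q') y.
have /= le1 := Rintegral_le_scale Q1 Q'1 M0 (fun h => @QQ' h y) bM.
have le2 : forall z, (if z \in S then delta s.+1 * f z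
                      else stop_value delta Q f S N s.+1 z) <=
    (if z \in S then delta s.+1 * f' z
     else stop_value delta Q' f' S N s.+1 z) + (N%:R * (M * eta) + kappa).
  move=> z; case: ifP => _; last exact: IH.
  have d0 := discount_ge0 dd s.+1; have d1 := discount_le1 dd s.+1.
  have Ne : 0 <= N%:R * (M * eta) by rewrite !mulr_ge0// ltW.
  have := ff' z; nra.
have := Rintegral_le_shift Q'1 b b' le2.
move: le1; rewrite /= -natr1; lra.
Qed.

Lemma tv_dist_Rintegral d (E : measurableType d) (R : realType)
    (P P' : {measure set E -> \bar R}) (eta : R) :
  P setT = 1%E -> P' setT = 1%E -> (tv_dist P P' <= eta%:E)%E ->
  forall g, meas_bounded 1 g ->
    \int[P]_z g z <= \int[P']_z g z + eta /\
    \int[P']_z g z <= \int[P]_z g z + eta.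
Proof.
move=> P1 P'1 tv.
have le1 g : meas_bounded 1 g -> \int[P]_z g z <= \int[P']_z g z + eta.
  move=> bg; have : (\int[P]_z (g z)%:E - \int[P']_z (g z)%:E <= eta%:E)%E.
    by apply: le_trans tv; apply: ereal_sup_ubound; exists g.
  by rewrite -(EFin_Rintegral P1 bg) -(EFin_Rintegral P'1 bg) lee_fin; lra.
move=> g bg; split; first exact: le1.
have [mg g1] := bg.
(* The supremum in [tv_dist] is one-sided; the test function [1 - g] yields the reverse
   inequality. *)
have bg' : meas_bounded 1 (fun z => 1 - g z).
  split; first exact: measurable_funB.
  by move=> z; have /andP[? ?] := g1 z; apply/andP; split; lra.
have compl (m : {measure set E -> \bar R}) : m setT = 1%E ->
    \int[m]_z (1 - g z) = 1 - \int[m]_z g z.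
  move=> m1; rewrite RintegralB//.
  - by rewrite Rintegral_prob_cst.
  - exact: integrable_cst1.
  - exact: meas_bounded_integrable bg.
by have := le1 _ bg'; rewrite !compl//; lra.
Qed.

(** The complement of a point is open for the metric. This makes the set of paths starting at [x] an
    event. *)
Lemma polish_set1_measurable (R : realType) (T : ptopologicalType) (x : T) :
  polish_space R T -> measurable ([set x] : set (borel T)).
Proof.
move=> [_ [d [dm dT _]]]; rewrite -[[set x]]setCK; apply: measurableC.
apply: sub_sigma_algebra; rewrite openE => y /= yx.
apply/dT; exists (d y x).
  rewrite lt_neqAle (metric_ge0 dm) andbT eq_sym.
  by apply/eqP => /(metric_eq0 dm).
by move=> z /= yz zx; move: yz; rewrite zx ltxx.
Qed.

(** * Limits inferior and superior, and limits as eps decreases to 0 *)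

Lemma limn_esup_le_near (R : realType) (u : nat -> \bar R) l :
  (\forall n \near \oo, (u n <= l)%E) -> (limn_esup u <= l)%E.
Proof.
move=> ul.
apply: (@le_trans _ _ (ereal_sup (u @` [set n | (u n <= l)%E]))); last first.
  by apply: ge_ereal_sup => _ [n /= unl <-].
by apply: ereal_inf_lbound; exists [set n | (u n <= l)%E].
Qed.

Lemma limn_einf_ge_near (R : realType) (u : nat -> \bar R) l :
  (\forall n \near \oo, (l <= u n)%E) -> (l <= limn_einf u)%E.
Proof.
move=> lu; rewrite /limn_einf leeNr; apply: limn_esup_le_near.
by apply: filterS lu => n; rewrite leeN2.
Qed.

(** The asymmetry mirrors the application: the lower bound holds at every positive [eps], the upper
    one only for small [eps] and up to [e]. *)
Lemma cvge_at_right0 (R : realType) (G : R -> \bar R) v :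
  v != -oo%E -> (forall eps, 0 < eps -> (v <= G eps)%E) ->
  (forall e, 0 < e -> exists2 eps0, 0 < eps0 &
     forall eps, 0 < eps < eps0 -> (G eps <= v + e%:E)%E) ->
  G eps @[eps --> 0^'+] --> v.
Proof.
move=> vNy vG Gv.
have near_e e : 0 < e -> \forall eps \near 0^'+, (v <= G eps <= v + e%:E)%E.
  move=> e0; have [eps0 eps00 h] := Gv _ e0.
  near=> eps; rewrite vG//=; apply: h; apply/andP; split => //.
case: v vNy vG Gv near_e => [v||]// _ vG Gv near_e.
  apply/fine_cvgP; split.
    apply: filterS (near_e 1 ltr01) => eps; case: (G eps) => [r||]//=.
      by rewrite andbF.
  apply/cvgrPdist_le => e e0; apply: filterS (near_e e e0) => eps /=.
  case: (G eps) => [r||]//=; last by rewrite andbF.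
  rewrite !lee_fin => /andP[vr re]; rewrite distrC ger0_norm; lra.
apply: cvg_near_cst; apply: filterS (near_e 1 ltr01) => eps.
by rewrite leye_eq => /andP[/eqP].
Unshelve. all: by end_near. Qed.

(** * Equilibrium values of the limit problem and of its approximations *)

Section Stability.
Context (R : realType) (T : ptopologicalType) (polishT : polish_space R T).
Context (dO : measure_display) (Omega : measurableType dO).
Context (X : nat -> {mfun Omega >-> borel T}).
Context (Prob : (R.-pker borel T ~> borel T) -> T -> probability Omega R).
Hypothesis markovX : markov_family X Prob.
Context (delta : nat -> R).
Hypothesis delta_discount : discount delta.

Definition continuation_value (Q : R.-pker borel T ~> borel T) (f : T -> R)
    (S : set T) (y : T) : R :=
  fine (continuation X Prob delta Q y S f).

Lemma continuation_value_bounds M Q f (S : set (borel T)) N y :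
  meas_bounded M (f : borel T -> R) -> measurable S ->
  continuation X Prob delta Q y S f = (continuation_value Q f S y)%:E /\
  stop_value delta Q f S N 0 y <= continuation_value Q f S y <=
  stop_value delta Q f S N 0 y + delta N * M.
Proof.
move=> bf mS.
have [c cE cN] := expectation_payoff_bounds delta_discount bf mS (markovX Q y)
  (polish_set1_measurable y polishT) N.
by rewrite /continuation_value /continuation cE.
Qed.

Lemma continuationE M Q f (S : set (borel T)) y :
  meas_bounded M (f : borel T -> R) -> measurable S ->
  continuation X Prob delta Q y S f = (continuation_value Q f S y)%:E.
Proof. by move=> bf mS; have [] := continuation_value_bounds Q 0 y bf mS. Qed.

Lemma JE M Q f (S : set (borel T)) y :
  meas_bounded M (f : borel T -> R) -> measurable S ->
  J X Prob delta Q y S f =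
  (if y \in S then f y else continuation_value Q f S y)%:E.
Proof. by move=> bf mS; rewrite /J (continuationE _ _ bf mS); case: ifP. Qed.

Lemma V_le_W Q eps y f :
  (V X Prob delta Q eps y f <= W X Prob delta Q eps y f)%E.
Proof.
by apply: ereal_sup_le => _ [S [mS pS eS] <-]; exists S.
Qed.

Section Limit.
Variables (M : R) (foo : borel T -> R) (Q : R.-pker borel T ~> borel T) (x : T).
Hypothesis foo_bnd : meas_bounded M foo.
Hypothesis delta_mul : forall s t, delta s * delta t <= delta (s + t)%N.

Let c := continuation_value Q foo.
Let v := V X Prob delta Q 0 x foo.

Let c_bounds (S : set (borel T)) N y : measurable S ->
  stop_value delta Q foo S N 0 y <= c S y <=
  stop_value delta Q foo S N 0 y + delta N * M.
Proof. by move=> /(continuation_value_bounds Q N y foo_bnd)[]. Qed.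

Lemma J_pseudo_le_V (S : set (borel T)) :
  measurable S -> (forall z, ~ S z -> foo z <= c S z) ->
  (J X Prob delta Q x S foo <= v)%E.
Proof.
move=> mS pS.
have [S' [mS' pS' eS' SS']] :=
  equilibrium_of_pseudo delta_discount foo_bnd c_bounds delta_mul x mS pS.
apply: (@le_trans _ _ (J X Prob delta Q x S' foo)).
  by rewrite (JE _ _ foo_bnd mS) (JE _ _ foo_bnd mS') lee_fin.
apply: ereal_sup_ubound; exists S' => //; split => // z zS'.
  by rewrite (continuationE _ _ foo_bnd mS') adde0 lee_fin pS'.
by rewrite (continuationE _ _ foo_bnd mS') adde0 lee_fin eS'.
Qed.

Lemma V_neqNy : v != -oo%E.
Proof.
(* The whole space is vacuously a pseudo-equilibrium, and its value is a real number. *)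
have := @J_pseudo_le_V setT measurableT (fun z n => False_ind _ (n I)).
by rewrite (JE _ _ foo_bnd measurableT); case: v.
Qed.

(** Otherwise there are pseudo 1/(k+1)-equilibria worth more than [v + e] at [x] for all [k]; their
    liminf is a pseudo 0-equilibrium worth at least [v + e], against [J_pseudo_le_V]. *)
Lemma W_cvg_V e : 0 < e -> exists2 eps, 0 < eps &
  (W X Prob delta Q eps x foo <= v + e%:E)%E.
Proof.
move=> e0; apply: contrapT => noeps.
have Wgt k : (v + e%:E < W X Prob delta Q k.+1%:R^-1 x foo)%E.
  by rewrite ltNge; apply/negP => le; apply: noeps; exists k.+1%:R^-1.
have /choice[S_ S_P] : forall k, exists S,
    pseudo_equilibria X Prob delta Q foo k.+1%:R^-1 S /\
    (v + e%:E < J X Prob delta Q x S foo)%E.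
  by move=> k; have /ereal_sup_gt[_ [S pS <-] ?] := Wgt k; exists S.
have mS_ k : measurable (S_ k : set (borel T)) by have [[]] := S_P k.
(* [v] is not [-oo] by [V_neqNy], nor [+oo] because [v + e] lies below a real value of [J]. *)
have [r vE] : exists r, v = r%:E.
  have := V_neqNy; have [_] := S_P 0%N.
  rewrite (JE _ _ foo_bnd (mS_ 0%N)); case: v => [r _ _|//|//].
  by exists r.
have [||S [mS pS]] := @pseudo_equilibrium_limit _ _ _ _ delta_discount _ _ _
    foo_bnd c c_bounds delta_mul S_ x (r + e) mS_.
- move=> k z zS; have [[_ pS] _] := S_P k.
  by have := pS z zS; rewrite (continuationE _ _ foo_bnd (mS_ k)) lee_fin.
- move=> k; have [_] := S_P k.
  by rewrite (JE _ _ foo_bnd (mS_ k)) vE lte_fin => /ltW.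
have := J_pseudo_le_V mS pS.
rewrite (JE _ _ foo_bnd mS) vE lee_fin => le1 le2.
by have := le_trans le2 le1; rewrite gerDl leNgt e0.
Qed.

Variables (Qn : nat -> R.-pker borel T ~> borel T) (f : nat -> T -> R).
Hypothesis reward_f : forall n, reward (f n).
Hypothesis cvgQ : ereal_sup (range (fun y : T => tv_dist (Qn n y) (Q y)))
  @[n --> \oo] --> (0 : \bar R)%E.
Hypothesis cvgf : sup_norm (f n \- foo) @[n --> \oo] --> (0 : \bar R)%E.

(** Uniformity in the target and the starting point comes from fixing one horizon [N]: later payoffs
    are worth at most [delta N * M1], and up to [N] [stop_value_perturb] applies. *)
Lemma near_uniform e : 0 < e -> \forall n \near \oo,
  [/\ forall y, `|f n y - foo y| <= e,
    meas_bounded (M + 1) (f n : borel T -> R) &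
    forall (S : set (borel T)) y, measurable S ->
      `|continuation_value (Qn n) (f n) S y - c S y| <= e].
Proof.
(* [M + 1] bounds [f n] as soon as it is within 1 of [foo], hence the cap 1 in [kappa] below. *)
move=> e0; pose M1 := M + 1.
have M0 : 0 <= M by have [_ /(_ point)/andP[]] := foo_bnd; exact: le_trans.
have M10 : 0 < M1 by rewrite ltr_wpDl.
(* The budget is a quarter of [e] each for the tail beyond [N], for the kernel over [N] steps and
   for the reward. *)
have [N dN] : exists N, delta N * M1 <= e / 4.
  have dM0 : delta N * M1 @[N --> \oo] --> 0.
    rewrite -(mul0r M1); apply: cvgM; last exact: cvg_cst.
    exact: discount_cvg.
  have e4 : 0 < e / 4 by lra.
  have [N _ /(_ N (leqnn N))] := (cvgrPdist_le _ _).1 dM0 _ e4.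
  by rewrite sub0r normrN ler_norml => /andP[_ ?]; exists N.
(* [N.+1] instead of [N] keeps the divisor positive when [N] is 0. *)
pose C := N.+1%:R * M1.
have C0 : 0 < C by rewrite mulr_gt0.
pose eta := e / 4 / C.
have eta0 : 0 < eta by rewrite !divr_gt0.
have Neta : N%:R * (M1 * eta) <= e / 4.
  have -> : e / 4 = C * eta by rewrite /eta mulrCA mulfV ?mulr1// gt_eqF.
  by rewrite mulrA ler_wpM2r ?(ltW eta0)// /C ler_wpM2r ?(ltW M10)// ler_nat.
pose kappa := Num.min 1 (e / 4).
have kappa0 : 0 < kappa by rewrite lt_min ltr01/= divr_gt0.
have [kappa1 kappae] : kappa <= 1 /\ kappa <= e / 4.
  by rewrite /kappa !ge_min !lexx orbT.
have near0 (u : nat -> \bar R) a : 0 < a -> u @ \oo --> 0%E ->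
    \forall n \near \oo, (u n <= a%:E)%E.
  move=> a0 u0; have [ufin uc] := (fine_cvgP _ _).1 u0.
  have /cvgrPdist_le/(_ _ a0) := uc.
  apply: filterS2 ufin => n /=; case: (u n) => [s|//|//] _ /=.
  by rewrite sub0r normrN lee_fin => /(le_trans (ler_norm _)).
apply: filterS2 (near0 _ _ eta0 cvgQ) (near0 _ _ kappa0 cvgf) => n tvn supn.
have fk y : `|f n y - foo y| <= kappa.
  by rewrite -lee_fin; apply: le_trans supn; apply: ereal_sup_ubound; exists y.
have tvy y : (tv_dist (Qn n y) (Q y) <= eta%:E)%E.
  by apply: le_trans tvn; apply: ereal_sup_ubound; exists y.
have bf : meas_bounded M1 (f n : borel T -> R).
  have [mf f0] := reward_f n; split => // z; rewrite f0/=.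
  have [_ /(_ z)/andP[_ fooM]] := foo_bnd.
  by have := fk z; rewrite ler_norml /M1 => /andP[? ?]; lra.
split => //.
  by move=> y; rewrite (le_trans (fk y))// (le_trans kappae)//; lra.
move=> S y mS.
have TV g z (bg : meas_bounded 1 g) :=
  tv_dist_Rintegral (prob_kernel (s := Qn n) z) (prob_kernel (s := Q) z)
    (tvy z) bg.
have b1 : meas_bounded M1 foo.
  have [mfoo fooM] := foo_bnd; split => // z.
  have /andP[-> /le_trans] := fooM z.
  by apply; rewrite lerDl.
have k1 z : f n z <= foo z + kappa.
  by have := fk z; rewrite ler_norml => /andP[? ?]; lra.
have k2 z : foo z <= f n z + kappa.
  by have := fk z; rewrite ler_norml => /andP[? ?]; lra.
have le1 := stop_value_perturb delta_discount M10 bf b1 (ltW eta0) (ltW kappa0)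
  (fun g z bg => (TV g z bg).1) k1 mS N 0 y.
have le2 := stop_value_perturb delta_discount M10 b1 bf (ltW eta0) (ltW kappa0)
  (fun g z bg => (TV g z bg).2) k2 mS N 0 y.
have [_ /andP[l1 u1]] := continuation_value_bounds (Qn n) N y bf mS.
have [_ /andP[l2 u2]] := continuation_value_bounds Q N y b1 mS.
rewrite -/c in l2 u2.
rewrite ler_norml; apply/andP; split; lra.
Qed.

Lemma J_dist n e (S : set (borel T)) : measurable S ->
  (forall y, `|f n y - foo y| <= e) ->
  meas_bounded (M + 1) (f n : borel T -> R) ->
  (forall (S : set (borel T)) y, measurable S ->
      `|continuation_value (Qn n) (f n) S y - c S y| <= e) ->
  (J X Prob delta (Qn n) x S (f n) <= J X Prob delta Q x S foo + e%:E /\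
   J X Prob delta Q x S foo <= J X Prob delta (Qn n) x S (f n) + e%:E)%E.
Proof.
move=> mS fe bf ce; rewrite (JE _ _ foo_bnd mS) (JE _ _ bf mS) -!EFinD !lee_fin.
have := fe x; have := ce S x mS; rewrite -/c.
by case: ifP => _; rewrite !ler_norml => /andP[? ?] /andP[? ?]; split; lra.
Qed.

(** An exact equilibrium of the limit problem is an [eps]-equilibrium for all large [n], since
    reward and continuation value each move by at most [eps / 2]; its value moves by at most [e]. *)
Lemma V_le_limn_einf eps (u : nat -> \bar R) : 0 < eps ->
  (forall n, V X Prob delta (Qn n) eps x (f n) <= u n)%E ->
  (v <= limn_einf u)%E.
Proof.
move=> eps0 Vu; apply: ge_ereal_sup => _ [S [mS pS eS] <-].
rewrite (JE _ _ foo_bnd mS); apply/lee_addgt0Pr => e e0.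
rewrite -leeBlDr//; apply: limn_einf_ge_near.
pose a := Num.min e (eps / 2).
have a0 : 0 < a by rewrite lt_min e0 divr_gt0.
have [ae aeps] : a <= e /\ a <= eps / 2 by rewrite /a !ge_min !lexx orbT.
apply: filterS (near_uniform a0) => n [fe bf ce].
have [_ J2] := J_dist mS fe bf ce.
rewrite leeBlDr// -(JE _ _ foo_bnd mS) (le_trans J2)//.
apply: leeD; last by rewrite lee_fin.
apply: le_trans (Vu n).
apply: ereal_sup_ubound; exists S => //; split => // z zS.
  have := pS z zS.
  rewrite (continuationE _ _ foo_bnd mS) (continuationE _ _ bf mS).
  have := fe z; have := ce S z mS.
  by rewrite -!EFinD !lee_fin !ler_norml -/c => /andP[? ?] /andP[? ?] ?; lra.
have := eS z zS.
rewrite (continuationE _ _ foo_bnd mS) (continuationE _ _ bf mS).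
have := fe z; have := ce S z mS.
by rewrite -!EFinD !lee_fin !ler_norml -/c => /andP[? ?] /andP[? ?] ?; lra.
Qed.

(** For large [n] a pseudo [eps]-equilibrium is a pseudo [eps1]-equilibrium of the limit problem:
    [eps] takes half of [eps1], and the changes of reward and continuation value a quarter each. One
    half of [e] is for [W_cvg_V], the other for the change of [J]. *)
Lemma limn_esup_W_le e : 0 < e -> exists2 eps0, 0 < eps0 &
  forall eps, 0 < eps < eps0 -> \forall n \near \oo,
    (W X Prob delta (Qn n) eps x (f n) <= v + e%:E)%E.
Proof.
move=> e0; have e2 : 0 < e / 2 by rewrite divr_gt0.
have [eps1 eps10 We] := W_cvg_V e2.
exists (eps1 / 2); first by rewrite divr_gt0.
move=> eps /andP[eps0 epslt].
pose a := Num.min (e / 2) (eps1 / 4).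
have a0 : 0 < a by rewrite lt_min e2 divr_gt0.
have [ae aeps] : a <= e / 2 /\ a <= eps1 / 4 by rewrite /a !ge_min !lexx orbT.
apply: filterS (near_uniform a0) => n [fe bf ce].
apply: ge_ereal_sup => _ [S [mS pS] <-].
have [J1 _] := J_dist mS fe bf ce.
apply: (le_trans J1).
have -> : (v + e%:E = v + (e / 2)%:E + (e / 2)%:E)%E.
  by rewrite -addeA -EFinD -splitr.
apply: leeD; last by rewrite lee_fin.
apply: le_trans We; apply: ereal_sup_ubound; exists S => //; split => // z zS.
have := pS z zS.
rewrite (continuationE _ _ foo_bnd mS) (continuationE _ _ bf mS).
have := fe z; have := ce S z mS.
by rewrite -!EFinD !lee_fin !ler_norml -/c => /andP[? ?] /andP[? ?] ?; lra.
Qed.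

(** The lower bound is proved for [V] and the upper one for [W], so anything in between has the same
    limits; the theorem takes [U] to be [V] and then [W]. *)
Lemma limn_between_cvg (U : R -> nat -> \bar R) :
  (forall eps n, V X Prob delta (Qn n) eps x (f n) <= U eps n)%E ->
  (forall eps n, U eps n <= W X Prob delta (Qn n) eps x (f n))%E ->
  limn_einf (U eps) @[eps --> 0^'+] --> v /\
  limn_esup (U eps) @[eps --> 0^'+] --> v.
Proof.
move=> VU UW.
have lower eps : 0 < eps -> (v <= limn_einf (U eps))%E.
  by move=> eps0; exact: V_le_limn_einf eps0 (VU eps).
have upper e : 0 < e -> exists2 eps0, 0 < eps0 &
    forall eps, 0 < eps < eps0 -> (limn_esup (U eps) <= v + e%:E)%E.
  move=> /limn_esup_W_le[eps0 eps00 h]; exists eps0 => // eps /h hW.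
  apply: limn_esup_le_near; apply: filterS hW => n.
  exact: le_trans.
split; apply: cvge_at_right0 V_neqNy _ _ => //.
- move=> e /upper[eps0 eps00 h]; exists eps0 => // eps /h.
  exact: le_trans (limn_einf_sup _).
- by move=> eps /lower/le_trans; apply; exact: limn_einf_sup.
Qed.

End Limit.
End Stability.

Theorem theorem4p1 (R : realType) (T : ptopologicalType)
    (polishT : polish_space R T)
    (dO : measure_display) (Omega : measurableType dO)
    (X : nat -> {mfun Omega >-> borel T})
    (Prob : (R.-pker borel T ~> borel T) -> T -> probability Omega R)
    (markovX : markov_family X Prob)
    (delta : nat -> R) (discount_delta : discount delta)
    (delta_mul : forall s t : nat, delta t * delta s <= delta (t + s)%N)
    (Q : nat -> R.-pker borel T ~> borel T) (Qoo : R.-pker borel T ~> borel T)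
    (f : nat -> T -> R) (foo : T -> R)
    (reward_f : forall n, reward (f n)) (bounded_f : forall n, bounded_fun (f n))
    (reward_foo : reward foo) (bounded_foo : bounded_fun foo)
    (cvgQ : ereal_sup (range (fun x : T => tv_dist (Q n x) (Qoo x)))
              @[n --> \oo] --> (0 : \bar R)%E)
    (cvgf : sup_norm (f n \- foo) @[n --> \oo] --> (0 : \bar R)%E)
    (x : T) :
  [/\ limn_einf (fun n => V X Prob delta (Q n) eps x (f n)) @[eps --> 0^'+]
        --> V X Prob delta Qoo 0 x foo,
      limn_einf (fun n => W X Prob delta (Q n) eps x (f n)) @[eps --> 0^'+]
        --> V X Prob delta Qoo 0 x foo,
      limn_esup (fun n => V X Prob delta (Q n) eps x (f n)) @[eps --> 0^'+]
        --> V X Prob delta Qoo 0 x foo &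
      limn_esup (fun n => W X Prob delta (Q n) eps x (f n)) @[eps --> 0^'+]
        --> V X Prob delta Qoo 0 x foo].
Proof.
have [M fooM] : exists M, meas_bounded M (foo : borel T -> R).
  have [mfoo foo0] := reward_foo; have [A [_ bA]] := bounded_foo.
  (* Boundedness supplies a bound by every number above [A]; this one is such a number. *)
  exists (`|A| + 1); split => // z; rewrite foo0/=.
  have := bA (`|A| + 1); rewrite ltr_pwDr ?ler_norm// => /(_ isT z I).
  by apply: le_trans; exact: ler_norm.
have dM s t : delta s * delta t <= delta (s + t)%N by exact: delta_mul.
have between := limn_between_cvg (x := x) polishT markovX discount_delta fooM dM
  reward_f cvgQ cvgf.
have [V_inf V_sup] := between
  (fun eps n => V X Prob delta (Q n) eps x (f n))
  (fun _ _ => lexx _) (fun eps n => V_le_W _ _ _ _ _ _ _).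
have [W_inf W_sup] := between
  (fun eps n => W X Prob delta (Q n) eps x (f n))
  (fun eps n => V_le_W _ _ _ _ _ _ _) (fun _ _ => lexx _).
by split.
Qed.
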